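(* Let $C_n(x)$ be the second-order Eulerian polynomials. Then for $n\ge1$, $$C_n(x)=\sum_{T\in\mathrm{SYT}(n)}\left(\prod_{i=1}^n\delta_i(T)\right)x^{\ell(\lambda(T))}.$$
   Context: A Stirling permutation of order $n$ is a permutation $\sigma=\sigma_1\cdots\sigma_{2n}$ of the multiset $\{1^2,2^2,\dots,n^2\}$ such that for each $i$ all entries between the two occurrences of $i$ are at least $i$; $\mathcal Q_n$ is the set of these. $C_n(x)=\sum_{\sigma\in\mathcal Q_n}x^{\mathrm{des}(\sigma)}$ with $\mathrm{des}(\sigma)=\#\{i\in[2n]:\sigma_i>\sigma_{i+1}\}$, $\sigma_{2n+1}=0$. A standard Young tableau of size $n$ is a filling of the Ferrers diagram of a partition $\lambda\vdash n$ (French convention: left-justified rows numbered from bottom to top, $\lambda_i$ boxes in row $i$) with $1,\dots,n$, each used exactly once, increasing from left to right in rows and from bottom to top in columns; $\mathrm{SYT}(n)$ is the set of all of them, over all $\lambda\vdash n$. For $T\in\mathrm{SYT}(n)$, $\ell(\lambda(T))$ is the number of rows of $T$, $T_i$ is the tableau obtained from $T$ by deleting the entries $i+1,\dots,n$, and $\mathrm{col}_k(T_i)$ is the number of boxes in the $k$-th column of $T_i$. The second-order box sorting index of $i$ is $$\delta_i(T)=\begin{cases}2i-\mathrm{col}_1(T_i), & \text{if } i \text{ is in the first column of } T,\\ \mathrm{col}_k(T_i)-\mathrm{col}_{k+1}(T_i)+1, & \text{if } i \text{ is in the } (k+1)\text{-th column of } T,\ k\ge1.\end{cases}$$ *)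

(* Defs.v *)
(* Mathematical Components. *)
From mathcomp Require Import all_boot all_order all_algebra.

Set Implicit Arguments.
Unset Strict Implicit.
Unset Printing Implicit Defensive.

Import GRing.Theory.
Local Open Scope nat_scope.

Definition is_stirling (n : nat) (s : seq nat) : bool :=
  perm_eq s (flatten [seq [:: i; i] | i <- iota 1 n]) &&
  [forall p : 'I_(2 * n), forall q : 'I_(2 * n), forall r : 'I_(2 * n),
     [&& p < q, q < r & nth 0 s p == nth 0 s r] ==> (nth 0 s p <= nth 0 s q)].

(* Positions are numbered from 0.  The convention that the word is followed by
   a 0 is the default value of [nth]. *)
Definition des (s : seq nat) : nat :=
  #|[set i : 'I_(size s) | nth 0 s i.+1 < nth 0 s i]|.

Definition word (n : nat) (s : (2 * n).-tuple 'I_n.+1) : seq nat :=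
  [seq val i | i <- s].

Definition stirling_perms (n : nat) : {set (2 * n).-tuple 'I_n.+1} :=
  [set s | is_stirling n (word s)].

Definition second_eulerian (n : nat) : {poly int} :=
  (\sum_(s in stirling_perms n) 'X^(des (word s)))%R.

Definition is_partition (n : nat) (lam : seq nat) : bool :=
  [&& sorted geq lam, 0 \notin lam & sumn lam == n].

(* A filling of a Ferrers diagram is the list of its rows, from bottom to top,
   each read from left to right.  Columns are numbered from 1 and read from
   bottom to top. *)
Definition column (k : nat) (t : seq (seq nat)) : seq nat :=
  [seq nth 0 r k.-1 | r <- t & k <= size r].

Definition is_SYT (n : nat) (t : seq (seq nat)) : bool :=
  [&& is_partition n (shape t),
      perm_eq (flatten t) (iota 1 n),
      all (sorted ltn) t
    & all (fun k => sorted ltn (column k t)) (iota 1 n)].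

Definition restrict (i : nat) (t : seq (seq nat)) : seq (seq nat) :=
  [seq r <- [seq [seq j <- r | j <= i] | r <- t] | r != [::]].

Definition col_size (k : nat) (t : seq (seq nat)) : nat := size (column k t).

Definition column_of (i : nat) (t : seq (seq nat)) : nat :=
  (index i (nth [::] t (find (fun r => i \in r) t))).+1.

Definition delta (i : nat) (t : seq (seq nat)) : int :=
  let ti := restrict i t in
  let k := (column_of i t).-1 in
  if k == 0 then ((2 * i)%:Z - (col_size 1 ti)%:Z)%R
  else ((col_size k ti)%:Z - (col_size k.+1 ti)%:Z + 1)%R.

(* A tableau of size n has at most n rows, at most n boxes in each row, and
   entries at most n, so it is represented in this finite type (exactly once:
   see [rows_inj] and [is_SYT_rows]). *)
Notation bounded_filling n := {bseq n of {bseq n of 'I_n.+1}}.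

Definition rows (n : nat) (T : bounded_filling n) : seq (seq nat) :=
  [seq [seq val j | j <- bseqval r] | r <- bseqval T].

Definition SYT (n : nat) : {set bounded_filling n} :=
  [set T | is_SYT n (rows T)].

Lemma rows_inj (n : nat) : injective (@rows n).
Proof.
move=> T U eqTU; apply: val_inj; move: eqTU; apply: inj_map => r s eqrs.
by apply: val_inj; move: eqrs; apply: inj_map; apply: val_inj.
Qed.

Lemma is_SYT_rows (n : nat) (t : seq (seq nat)) :
  is_SYT n t -> exists T : bounded_filling n, rows T = t.
Proof.
case/and4P=> /and3P[_ t0 /eqP sz_t] /perm_mem mem_t _ _.
have le_row r : r \in t -> 0 < size r <= n.
  move=> tr; rewrite lt0n; apply/andP; split.
    by apply: contra t0 => /eqP <-; apply: map_f.
  rewrite -sz_t; elim: t tr {t0 sz_t mem_t} => //= a t IHt.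
  rewrite inE => /predU1P[-> | /IHt le_r]; first exact: leq_addr.
  exact: leq_trans le_r (leq_addl _ _).
have le_t : size t <= n.
  rewrite -sz_t; elim: t le_row {t0 sz_t mem_t} => //= a t IHt le_row.
  rewrite -add1n leq_add //; last first.
    by apply: IHt => r tr; apply: le_row; rewrite inE tr orbT.
  by case/andP: (le_row a (mem_head _ _)).
have le_entry r j : r \in t -> j \in r -> j < n.+1.
  move=> tr rj; have: j \in flatten t by apply/flattenP; exists r.
  by rewrite mem_t mem_iota add1n => /andP[].
pose f (r : seq nat) : {bseq n of 'I_n.+1} :=
  insub_bseq n [seq inord j | j <- r].
have le_ft : size [seq f r | r <- t] <= n by rewrite size_map.
exists (Bseq le_ft); rewrite /rows /= -map_comp -[RHS]map_id.
apply/eq_in_map => r tr /=; rewrite /f /insub_bseq insubdK.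
  rewrite -map_comp -[RHS]map_id; apply/eq_in_map => j rj /=.
  by rewrite inordK //; apply: le_entry rj.
by rewrite -topredE /= size_map; case/andP: (le_row r tr).
Qed.

(* Main.v *)
Require Import Defs.
From mathcomp Require Import all_boot all_order all_algebra.

Set Implicit Arguments.
Unset Strict Implicit.
Unset Printing Implicit Defensive.

Import GRing.Theory.
Local Open Scope nat_scope.

(** The identity is proved by showing that both sides satisfy the recurrence
    F_{n+1} = (2n+1) x F_n + x (1-x) F_n', whose effect on a monomial is
      x^k  |->  k x^k + (2n+1-k) x^(k+1),
    and that both equal 1 for n = 0.

    For words: in a Stirling permutation of order n+1 the two largest letters
    are adjacent, so it arises in a unique way from a Stirling permutation of
    order n by inserting the pair n+1, n+1 into one of its 2n+1 gaps (before
    the first letter, between two letters, or at the end).  The pair creates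
    one descent, and destroys one exactly when the gap was already a descent.
    A word with k descents thus has k gaps that keep the number of descents
    and 2n+1-k gaps that increase it ([des_insert_pair], [sum_insert_pair]).

    For tableaux: a tableau of size n+1 arises in a unique way from one of size
    n, with l rows say, by adding a box containing n+1.  The indices delta_i for
    i <= n are unchanged.  A box added on top of the first column gives
    delta_{n+1} = 2(n+1) - (l+1) = 2n+1-l and increases the number of rows.  A
    box added in column c+1 >= 2 keeps the number of rows, and delta_{n+1} is
    then col_c - col_{c+1}, the number of rows of length c.  Such a box can be
    added exactly when some row has length c, so the indices of all these boxes
    add up to l ([delta_grow_new], [sum_grow]).  The second-order index is
    thus designed so that the rows of a tableau behave like descents. *)

(** * The recurrence *)

Definition euler_step (n : nat) (p : {poly int}) : {poly int} :=
  ((2 * n + 1)%:Z *: ('X * p) + 'X * (1 - 'X) * p^`())%R.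

Lemma euler_step_sum n (I : Type) (r : seq I) (a : I -> int)
    (p : I -> {poly int}) :
  (euler_step n (\sum_(i <- r) a i *: p i) =
   \sum_(i <- r) a i *: euler_step n (p i))%R.
Proof.
rewrite /euler_step raddf_sum !mulr_sumr scaler_sumr -big_split /=.
apply: eq_bigr => i _; rewrite derivZ -!scalerAr scalerDr; congr (_ + _)%R.
by rewrite !scalerA mulrC.
Qed.

Lemma euler_stepXn n k :
  (euler_step n 'X^k = k%:Z *: 'X^k + ((2 * n + 1)%:Z - k%:Z) *: 'X^(k.+1))%R.
Proof.
rewrite /euler_step derivXn -exprS scalerBl addrCA; congr (_ + _)%R.
case: k => [|k]; first by rewrite mulr0n mulr0 !scale0r subr0.
rewrite -scaler_nat natz -scalerAr -scalerBr [('X * _)%R]mulrC -mulrA -exprS.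
by rewrite mulrBl mul1r -exprS.
Qed.

(** Transfers a sum over a subset of a finite type of bounded objects to an
    enumeration of the unbounded objects that they represent; the enumerations
    below are recursive, which is what makes the recurrence visible. *)
Lemma sum_image (T : finType) (U : eqType) (f : T -> U) (P : pred U) (l : seq U)
    (F : U -> {poly int}) :
  injective f -> uniq l -> l =i P -> (forall u, P u -> exists x, f x = u) ->
  (\sum_(x in [set x | P (f x)]) F (f x) = \sum_(u <- l) F u)%R.
Proof.
move=> inj_f uniq_l mem_l surj_f.
rewrite -big_enum -(big_map f xpredT) /=; apply: perm_big.
apply: uniq_perm => // [|u]; first by rewrite map_inj_uniq ?enum_uniq.
rewrite mem_l; apply/mapP/idP => [[x] | Pu].
  by rewrite mem_enum inE => Pfx ->.
by have [x def_u] := surj_f u Pu; exists x => //; rewrite mem_enum inE def_u.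
Qed.

(** * Stirling permutations *)

(** The Stirling condition as avoidance of a pattern: unlike the formulation
    with positions, it is stable under deletion of letters. *)
Definition nested (s : seq nat) : Prop :=
  forall x y, subseq [:: x; y; x] s -> x <= y.

Lemma subseq_nth (T : eqType) (x0 : T) (t s : seq T) :
  reflect (exists ps, [/\ sorted ltn ps, all (gtn (size s)) ps
                        & t = [seq nth x0 s p | p <- ps]])
          (subseq t s).
Proof.
apply: (iffP idP) => [/subseqP[m sz_m ->] | [ps [sorted_ps lt_ps ->]]].
  exists (mask m (iota 0 (size s))); split.
  - apply: subseq_sorted (mask_subseq _ _) (iota_ltn_sorted _ _).
    exact: ltn_trans.
  - by apply/allP=> p /mem_mask; rewrite mem_iota.
  - by rewrite map_mask map_nth_iota0 // take_size.
rewrite -[X in subseq _ X](take_size s) -(map_nth_iota0 x0) //; apply: map_subseq.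
have -> : ps = [seq p <- iota 0 (size s) | p \in ps].
  apply: (irr_sorted_eq ltn_trans ltnn) => //.
    exact/sorted_filter/iota_ltn_sorted/ltn_trans.
  move=> p; rewrite mem_filter mem_iota /= add0n.
  by case: (boolP (p \in ps)) => // /(allP lt_ps).
exact: filter_subseq.
Qed.

Lemma nestedP n s : size s = 2 * n ->
  reflect (nested s)
    [forall p : 'I_(2 * n), forall q : 'I_(2 * n), forall r : 'I_(2 * n),
       [&& p < q, q < r & nth 0 s p == nth 0 s r] ==> (nth 0 s p <= nth 0 s q)].
Proof.
move=> sz_s; apply: (iffP idP) => [nest x y | nest].
  case/(subseq_nth 0) => [[|p [|q [|r [|? ?]]]]] [] //=.
  rewrite sz_s !andbT => /andP[ltpq ltqr] /and3P[p_lt q_lt r_lt] [-> -> eqpr].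
  have /forallP/(_ (Ordinal q_lt))/forallP/(_ (Ordinal r_lt))/implyP :=
    forallP nest (Ordinal p_lt).
  by apply; rewrite /= ltpq ltqr eqpr eqxx.
apply/forallP=> p; apply/forallP=> q; apply/forallP=> r.
apply/implyP=> /and3P[ltpq ltqr /eqP eqpr]; apply: nest.
apply/(subseq_nth 0); exists [:: p : nat; q : nat; r : nat] => /=.
by rewrite ltpq ltqr sz_s !ltn_ord eqpr.
Qed.

Definition insert_pair (v p : nat) (s : seq nat) : seq nat :=
  take p s ++ [:: v; v] ++ drop p s.

Lemma insert_pair_perm v p s : perm_eq (insert_pair v p s) [:: v, v & s].
Proof.
by rewrite /insert_pair perm_catCA /= !perm_cons cat_take_drop.
Qed.

Lemma filter_insert_pair v p s :
  v \notin s -> [seq x <- insert_pair v p s | x != v] = s.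
Proof.
move=> vNs; rewrite /insert_pair !filter_cat /= eqxx /=.
rewrite -filter_cat cat_take_drop; apply/all_filterP/allP=> x xs.
by apply: contraNneq vNs => <-.
Qed.

Lemma index_insert_pair v p s :
  v \notin s -> p <= size s -> index v (insert_pair v p s) = p.
Proof.
move=> vNs le_p; rewrite index_cat /= eqxx addn0 size_takel //.
by case: ifP => // /mem_take; rewrite (negPf vNs).
Qed.

Lemma subseq_cons_notin (T : eqType) (v : T) t a u :
  v \notin a -> subseq (v :: t) (a ++ u) = subseq (v :: t) u.
Proof.
elim: a => //= x a IH; rewrite inE negb_or => /andP[/negPf nvx /IH <-].
by rewrite nvx.
Qed.

(** A forbidden pattern x y x of the extended word cannot use v as y, since v is
    maximal, nor as x, since the two copies of v are adjacent; so it would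
    already occur in s. *)
Lemma nested_insert_pair v p s :
  all (gtn v) s -> nested s -> nested (insert_pair v p s).
Proof.
move=> lt_v nest x y sub.
have vNs : v \notin s by apply/negP=> /(allP lt_v); rewrite /= ltnn.
have lev z : z \in insert_pair v p s -> z <= v.
  rewrite (perm_mem (insert_pair_perm _ _ _)) !inE orbA orbb.
  by case/predU1P=> [->|/(allP lt_v)/ltnW].
have xs : x \in insert_pair v p s.
  by apply: (mem_subseq sub); rewrite inE eqxx.
have [->|nyv] := eqVneq y v; first exact: lev.
have [xv|nxv] := eqVneq x v; last first.
  apply: nest; rewrite -(filter_insert_pair p vNs) subseq_filter sub /=.
  by rewrite nxv nyv.
case/negP: (vNs); move: sub; rewrite xv /insert_pair.
rewrite subseq_cons_notin; last by apply: contra vNs; apply: mem_take.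
rewrite /= eqxx (negPf nyv) => /mem_subseq/(_ v).
by rewrite !inE eqxx orbT => /(_ isT)/mem_drop.
Qed.

(** A letter between the two copies of the maximum v would have to be at least v,
    hence a third copy. *)
Lemma nested_max_adjacent v s :
  all (geq v) s -> count_mem v s = 2 -> nested s ->
  exists2 p, p < (size s).-1 & s = insert_pair v p [seq x <- s | x != v].
Proof.
move=> le_v cnt_v nest; have vs : v \in s by rewrite -has_pred1 has_count cnt_v.
move: (drop_index vs) (cat_take_drop (index v s) s).
set a := take _ s; set u := drop _.+1 s => -> def_s; rewrite -def_s in cnt_v nest *.
have vNa : v \notin a by rewrite in_take // ltnn.
move: le_v; rewrite -def_s all_cat => /and3P[_ _ le_u].
move: cnt_v; rewrite count_cat /= eqxx (count_memPn vNa) add0n add1n => -[].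
case: u le_u {def_s} nest => //= y b /andP[le_y le_b] nest.
have [-> [/eqP]|nyv cnt_b] := eqVneq y v; last first.
  (* the second copy of v comes later, so y lies between the two copies *)
  have /nest : subseq [:: v; y; v] (a ++ [:: v, y & b]).
    rewrite subseq_cons_notin //= !eqxx sub1seq -has_pred1 has_count.
    by move: cnt_b; rewrite add0n => ->.
  by rewrite leqNgt ltn_neqAle nyv le_y.
rewrite -leqn0 leqNgt -has_count has_pred1 => vNb.
have id_filter w : v \notin w -> [seq x <- w | x != v] = w.
  by move=> vNw; apply/all_filterP/allP=> x; apply: contraTneq => ->.
exists (size a); first by rewrite size_cat /= !addnS ltnS leq_addr.
rewrite filter_cat /= eqxx /= !id_filter //.
by rewrite /insert_pair take_size_cat // drop_size_cat.
Qed.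

Definition letters n := flatten [seq [:: i; i] | i <- iota 1 n].

Lemma lettersS n : perm_eq (letters n.+1) [:: n.+1, n.+1 & letters n].
Proof.
rewrite /letters -[in X in perm_eq X _](addn1 n) iotaD map_cat flatten_cat /=.
by rewrite add1n perm_catC.
Qed.

Lemma size_letters n : size (letters n) = 2 * n.
Proof.
by elim: n => // n IH; rewrite (perm_size (lettersS n)) /= IH mulnS.
Qed.

Lemma letters_le n x : x \in letters n -> x <= n.
Proof.
elim: n => // n IH; rewrite (perm_mem (lettersS n)) !inE orbA orbb.
by case/predU1P=> [->|/IH/leqW].
Qed.

Lemma is_stirlingP n s :
  reflect (perm_eq s (letters n) /\ nested s) (is_stirling n s).
Proof.
apply: (iffP andP) => -[perm_s]; have:= perm_size perm_s;
  by rewrite size_letters => sz_s /(nestedP sz_s).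
Qed.

Fixpoint stirling_words n : seq (seq nat) :=
  if n is m.+1
  then [seq insert_pair n p s | s <- stirling_words m, p <- iota 0 (2 * m + 1)]
  else [:: [::]].

Lemma mem_stirling_words n s : (s \in stirling_words n) = is_stirling n s.
Proof.
elim: n s => [|n IH] s.
  rewrite inE; apply/eqP/is_stirlingP => [-> | [/perm_nilP //]].
  by split=> //= x y.
apply/allpairsP/is_stirlingP => [[[s' p] /= []] | [perm_s nest]].
  rewrite IH mem_iota /= => /is_stirlingP[perm_s' nest] _ ->; split.
    rewrite (perm_trans (insert_pair_perm _ _ _)) // perm_sym.
    by rewrite (perm_trans (lettersS n)) // !perm_cons perm_sym.
  apply: nested_insert_pair nest; apply/allP => x.
  by rewrite (perm_mem perm_s') => /letters_le.
have Nn : n.+1 \notin letters n by apply/negP=> /letters_le; rewrite ltnn.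
have perm_sn := perm_trans perm_s (lettersS n).
have le_s : all (geq n.+1) s.
  by apply/allP=> x; rewrite (perm_mem perm_s); apply: letters_le.
have cnt_s : count_mem n.+1 s = 2.
  by rewrite (permP perm_sn) /= eqxx (count_memPn Nn).
have [p lt_p def_s] := nested_max_adjacent le_s cnt_s nest.
exists ([seq x <- s | x != n.+1], p) => /=; split=> //.
- rewrite IH; apply/is_stirlingP; split.
    rewrite (perm_trans (perm_filter _ perm_sn)) //= eqxx /=.
    rewrite (all_filterP _) //; apply/allP=> x xn.
    by apply: contraNneq Nn => <-.
  by move=> x y sub; apply/nest/(subseq_trans sub)/filter_subseq.
- rewrite mem_iota add0n addn1 /=; move: lt_p.
  by rewrite (perm_size perm_sn) /= size_letters.
Qed.

(** The inserted pair and its gap can be read off the word: delete the maximum,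
    and take the index of its first occurrence. *)
Lemma stirling_words_uniq n : uniq (stirling_words n).
Proof.
elim: n => // n IH; apply: allpairs_uniq => //; first exact: iota_uniq.
move=> _ _ /allpairsP[[s p] /= [sn pn ->]] /allpairsP[[s' p'] /= [s'n p'n ->]] /=.
have props u : u \in stirling_words n -> n.+1 \notin u /\ size u = 2 * n.
  rewrite mem_stirling_words => /is_stirlingP[perm_u _].
  rewrite (perm_mem perm_u) (perm_size perm_u) size_letters; split=> //.
  by apply/negP=> /letters_le; rewrite ltnn.
have [[Ns sz_s] [Ns' sz_s']] := (props s sn, props s' s'n).
move: pn p'n; rewrite !mem_iota /= add0n addn1 !ltnS => pn p'n eqs; congr (_, _).
  by rewrite -(filter_insert_pair p Ns) eqs filter_insert_pair.
by rewrite -(@index_insert_pair n.+1 p s) ?sz_s // eqs index_insert_pair ?sz_s'.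
Qed.

Lemma des_count s :
  des s = count (fun p => nth 0 s p.+1 < nth 0 s p) (iota 0 (size s)).
Proof.
rewrite /des -sum1dep_card -sum1_count -[X in iota 0 X]subn0.
by rewrite -/(index_iota 0 (size s)) big_mkord.
Qed.

Lemma des_cons x s : des (x :: s) = (nth 0 s 0 < x) + des s.
Proof. by rewrite !des_count /= (iotaDl 1) count_map. Qed.

(** Gap p lies just before position p; the 0 put in front of the word says that
    the initial gap is not a descent. *)
Definition descent_gap s p := nth 0 s p < nth 0 (0 :: s) p.

Lemma count_descent_gap s :
  count (descent_gap s) (iota 0 (size s).+1) = des s.
Proof.
by rewrite des_count /= (iotaDl 1) count_map.
Qed.

(** Around the new pair the word rises to v and falls after it, so the pair
    contributes one descent whatever its neighbours are, in place of the descent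
    that the gap may have carried. *)
Lemma des_insert_pair v p s : 0 < v -> all (gtn v) s -> p <= size s ->
  des (insert_pair v p s) = des s + ~~ descent_gap s p.
Proof.
move=> v_gt0; elim: p s => [|p IH] [|x s] //=.
- by move=> _ _; rewrite /insert_pair /= !des_cons /= ltnn v_gt0 add0n addnC.
- case/andP=> lt_x _ _.
  by rewrite /insert_pair /= !des_cons /= ltnn lt_x /descent_gap /= add0n addnC.
case/andP=> lt_x lt_s le_p.
have -> : insert_pair v p.+1 (x :: s) = x :: insert_pair v p s by [].
rewrite !des_cons IH // /descent_gap /=; case: p le_p {IH} => [|p] le_p.
  rewrite /insert_pair take0 /= [v < x]ltnNge ltnW //= add0n.
  by case: (_ < _); rewrite /= ?addn0 // addnC.
by rewrite /insert_pair; case: s le_p {lt_s} => //= y s le_p; rewrite addnA.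
Qed.

Lemma sum_insert_pair n s : is_stirling n s ->
  (\sum_(p <- iota 0 (2 * n + 1)) 'X^(des (insert_pair n.+1 p s)) =
   euler_step n 'X^(des s))%R.
Proof.
case/is_stirlingP=> perm_s _.
have sz_s : size s = 2 * n by rewrite (perm_size perm_s) size_letters.
have lt_s : all (gtn n.+1) s.
  by apply/allP=> x; rewrite (perm_mem perm_s) => /letters_le.
rewrite (eq_big_seq (fun p =>
    if descent_gap s p then 'X^(des s) else 'X^((des s).+1))%R); last first.
  move=> p; rewrite mem_iota add0n addn1 => /andP[_ le_p].
  by rewrite des_insert_pair ?sz_s //; case: ifP; rewrite ?addn0 ?addn1.
rewrite -sz_s addn1 big_if /= !big_const_seq !iter_addr_0 euler_stepXn.
rewrite -sz_s addn1 -!scaler_nat !natz; congr (_ *: _ + _ *: _)%R.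
  by rewrite count_descent_gap.
have := count_predC (descent_gap s) (iota 0 (size s).+1).
rewrite size_iota => sum_gaps; rewrite -[in RHS]sum_gaps count_descent_gap.
by rewrite PoszD addrAC subrr add0r.
Qed.

Lemma word_inj n : injective (@word n).
Proof. by move=> s t /(inj_map val_inj) /val_inj. Qed.

Lemma is_stirling_word n s :
  is_stirling n s -> exists w : (2 * n).-tuple 'I_n.+1, word w = s.
Proof.
case/is_stirlingP=> perm_s _.
have sz_s : size [seq inord i : 'I_n.+1 | i <- s] == 2 * n.
  by rewrite size_map (perm_size perm_s) size_letters.
exists (Tuple sz_s); rewrite /word /= -map_comp -[RHS]map_id.
apply/eq_in_map => i; rewrite (perm_mem perm_s) => /letters_le le_i /=.
exact: inordK.
Qed.

Lemma second_eulerian_list n :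
  (second_eulerian n = \sum_(s <- stirling_words n) 'X^(des s))%R.
Proof.
apply: (sum_image (fun s => 'X^(des s))%R (@word_inj n)
         (stirling_words_uniq n)).
  by move=> s; apply: mem_stirling_words.
exact: is_stirling_word.
Qed.

Lemma stirling_step n :
  (second_eulerian n.+1 = euler_step n (second_eulerian n))%R.
Proof.
rewrite !second_eulerian_list big_allpairs_dep.
rewrite -[X in _ = euler_step n X](eq_bigr _ (fun s _ => scale1r _)) euler_step_sum.
by apply: eq_big_seq => s; rewrite mem_stirling_words scale1r => /sum_insert_pair.
Qed.

(** * Adding the largest entry to a tableau *)

(** The new box is placed by the length c of the row that it extends, not by the
    number of the row: in a partition shape only the first row of length c can be
    extended, and c = 0 opens a new row.  The boxes that may be added are thus
    indexed by the distinct elements of 0 :: shape t. *)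
Fixpoint grow (v c : nat) (t : seq (seq nat)) : seq (seq nat) :=
  if t is r :: t' then
    if size r == c then rcons r v :: t' else r :: grow v c t'
  else [:: [:: v]].

Definition partition_shape (t : seq (seq nat)) : bool :=
  sorted geq (shape t) && (0 \notin shape t).

Lemma geq_trans : transitive geq.
Proof. by move=> y x z /= lexy leyz; apply: leq_trans leyz lexy. Qed.

Lemma partition_shape_cons r t :
  partition_shape (r :: t) =
  [&& size r != 0, all (fun r' => size r' <= size r) t & partition_shape t].
Proof.
rewrite /partition_shape /= (path_sortedE geq_trans) all_map inE negb_or eq_sym.
by rewrite -!andbA; do !bool_congr.
Qed.

Lemma flatten_grow v c t : perm_eq (flatten (grow v c t)) (v :: flatten t).
Proof.
elim: t => //= r t IH; case: eqP => _ /=.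
  by rewrite -cats1 -catA; apply/permPl/(perm_catCA r [:: v]).
by apply: perm_trans (permEl (perm_catCA r [:: v] _)); rewrite perm_cat2l.
Qed.

Lemma size_grow v c t : partition_shape t -> c \in 0 :: shape t ->
  size (grow v c t) = size t + (c == 0).
Proof.
elim: t => [|r t IH] /=; first by rewrite inE => _ /eqP->.
rewrite partition_shape_cons => /and3P[r0 _ part_t] c_t.
have [eq_rc|neq_rc] := eqVneq (size r) c; first by rewrite -eq_rc (negPf r0) addn0.
by rewrite /= IH //; move: c_t; rewrite !inE [c == size r]eq_sym (negPf neq_rc).
Qed.

Lemma partition_shape_grow v c t : partition_shape t -> c \in 0 :: shape t ->
  partition_shape (grow v c t).
Proof.
elim: t => [|r t IH] //=.
rewrite partition_shape_cons => /and3P[r0 le_r part_t] c_t.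
have [eq_rc|neq_rc] := eqVneq (size r) c; rewrite partition_shape_cons.
  rewrite size_rcons part_t andbT /=.
  by apply/allP=> r' /(allP le_r)/leqW.
have c_t' : c \in 0 :: shape t.
  by move: c_t; rewrite !inE [c == size r]eq_sym (negPf neq_rc).
rewrite r0 IH // andbT /=.
have lt_c : c < size r.
  rewrite ltn_neqAle eq_sym neq_rc /=; move: c_t'; rewrite inE.
  by case/predU1P=> [->//|/mapP[r' /(allP le_r) ? ->]].
elim: t le_r {part_t c_t c_t' IH} => [|r' t IH] /=.
  by rewrite andbT (leq_ltn_trans _ lt_c).
case/andP=> le_r' le_t; case: eqP => [eq_c|_] /=; last by rewrite le_r' IH.
by rewrite size_rcons eq_c lt_c.
Qed.

(** The rows longer than c all precede the extended one, so the new box is the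
    top box of column c + 1. *)
Lemma column_grow v c k t : partition_shape t -> c \in 0 :: shape t -> 0 < k ->
  column k (grow v c t) = if k == c.+1 then rcons (column k t) v else column k t.
Proof.
case: k => // k; rewrite eqSS => + + _; elim: t => [|r t IH] /=.
  by rewrite inE /column /= => _ /eqP ->; case: k.
rewrite partition_shape_cons => /and3P[r0 le_r part_t] c_t.
have [eq_rc|neq_rc] := eqVneq (size r) c; last first.
  have c_t' : c \in 0 :: shape t.
    by move: c_t; rewrite !inE [c == size r]eq_sym (negPf neq_rc).
  rewrite /column /=; case: ifP => _ /=;
    by move: (IH part_t c_t'); rewrite /column /= => ->; case: ifP.
rewrite /column /= size_rcons eq_rc ltnS.
case: (ltngtP k c) => [lt_kc|//|->].
  by rewrite /= nth_rcons eq_rc lt_kc.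
rewrite /= nth_rcons eq_rc ltnn eqxx.
rewrite (_ : filter _ t = [::]) //; apply/eqP; rewrite -[_ == _]negbK -has_filter.
by apply/hasPn => r' /(allP le_r); rewrite eq_rc -leqNgt.
Qed.

Lemma restrict_grow i v c t : i < v -> restrict i (grow v c t) = restrict i t.
Proof.
move=> lt_iv; have v0 : (v <= i) = false by rewrite leqNgt lt_iv.
rewrite /restrict; elim: t => [|r t IH] /=; first by rewrite v0.
case: ifP => _ /=; last by rewrite IH.
by rewrite filter_rcons v0.
Qed.

Lemma restrict_id n t :
  all (geq n) (flatten t) -> 0 \notin shape t -> restrict n t = t.
Proof.
rewrite /restrict; elim: t => //= r t IH; rewrite all_cat inE negb_or.
case/andP=> le_r le_t /andP[r0 t0]; rewrite (all_filterP le_r) IH //.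
by case: r r0 {le_r}.
Qed.

Lemma column_of_cons i r t :
  column_of i (r :: t) = if i \in r then (index i r).+1 else column_of i t.
Proof. by rewrite /column_of /=; case: ifP. Qed.

Lemma column_of_grow i v c t : i != v -> column_of i (grow v c t) = column_of i t.
Proof.
move=> niv; elim: t => [|r t IH] /=.
  by rewrite column_of_cons inE (negPf niv).
case: ifP => _; rewrite !column_of_cons ?IH // mem_rcons inE (negPf niv) /=.
by case: ifP => // ir; rewrite -cats1 index_cat ir.
Qed.

Lemma column_of_new v c t : v \notin flatten t -> c \in 0 :: shape t ->
  column_of v (grow v c t) = c.+1.
Proof.
elim: t => [|r t IH] /=.
  by rewrite column_of_cons !inE eqxx /= eqxx => _ /eqP->.
rewrite mem_cat negb_or => /andP[vNr vNt] c_t.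
have [<-|neq_rc] := eqVneq (size r) c; rewrite column_of_cons.
  by rewrite mem_rcons mem_head -cats1 index_cat (negPf vNr) /= eqxx addn0.
rewrite (negPf vNr) IH //.
by move: c_t; rewrite !inE [c == size r]eq_sym (negPf neq_rc).
Qed.

Lemma delta_grow_old i v c t : i < v -> delta i (grow v c t) = delta i t.
Proof.
by move=> lt_iv; rewrite /delta restrict_grow // column_of_grow // ltn_eqF.
Qed.

Lemma col_size_count k t : col_size k t = count (leq k) (shape t).
Proof. by rewrite /col_size /column size_map size_filter count_map. Qed.

(** For c > 0 the index is the difference of the lengths of columns c and c + 1
    of t, which counts the rows that reach column c but not column c + 1. *)
Lemma delta_grow_new v c t :
  partition_shape t -> c \in 0 :: shape t -> all (gtn v) (flatten t) ->
  delta v (grow v c t) =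
  (if c == 0 then (2 * v)%:Z - (size t).+1%:Z else (count_mem c (shape t))%:Z)%R.
Proof.
move=> part_t c_t lt_v.
have vNt : v \notin flatten t by apply/negP=> /(allP lt_v); rewrite /= ltnn.
rewrite /delta restrict_id; first last.
- by case/andP: (partition_shape_grow v part_t c_t).
- rewrite (perm_all _ (flatten_grow _ _ _)) /= leqnn /=.
  by apply: sub_all lt_v => x /ltnW.
rewrite column_of_new //=; case: eqP => [c0|/eqP c_neq0].
  rewrite /col_size column_grow // c0 /= size_rcons.
  congr (_ - (_.+1)%:Z)%R; rewrite -/(col_size 1 t) col_size_count.
  rewrite -(size_map size t); apply/eqP; rewrite -all_count; apply/allP=> x xt.
  by rewrite lt0n; apply: contraTneq xt => ->; case/andP: part_t.
rewrite /col_size !column_grow ?lt0n // eqxx ltn_eqF // size_rcons.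
rewrite -!/(col_size _ t) !col_size_count.
have -> : count (leq c) (shape t) =
          count_mem c (shape t) + count (leq c.+1) (shape t).
  rewrite -count_predUI (eq_count (_ : predI _ _ =1 pred0)); last first.
    by move=> x /=; case: ltngtP.
  by rewrite count_pred0 addn0; apply: eq_count => x /=; rewrite leq_eqVlt eq_sym.
by rewrite PoszD intS opprD addrACA subrr addr0 subrK.
Qed.

(** * Enumeration of standard Young tableaux *)

Lemma sorted_rcons_max v s : all (gtn v) s -> sorted ltn (rcons s v) = sorted ltn s.
Proof.
move=> lt_v; rewrite !(sorted_pairwise ltn_trans) -cats1 pairwise_cat allrel1r /=.
by rewrite andbT (lt_v : all (ltn^~ v) s).
Qed.

Lemma column_sub k t x : 0 < k -> x \in column k t -> x \in flatten t.
Proof.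
move=> k0 /mapP[r]; rewrite mem_filter => /andP[le_k rt] ->.
by apply/flattenP; exists r => //; rewrite mem_nth // prednK.
Qed.

Lemma shape_le_sumn (T : eqType) (t : seq (seq T)) r :
  r \in t -> size r <= sumn (shape t).
Proof.
elim: t => //= a t IH; rewrite inE => /predU1P[->|/IH le_r]; first exact: leq_addr.
exact: leq_trans le_r (leq_addl _ _).
Qed.

Lemma column_nil k t : sumn (shape t) < k -> column k t = [::].
Proof.
move=> lt_k; rewrite /column (_ : filter _ t = [::]) //.
apply/eqP; rewrite -[_ == _]negbK -has_filter; apply/hasPn=> r /shape_le_sumn le_r.
by rewrite -ltnNge (leq_ltn_trans le_r).
Qed.

Lemma iota1S n : iota 1 n.+1 = rcons (iota 1 n) n.+1.
Proof. by rewrite -cats1 -[in LHS](addn1 n) iotaD add1n. Qed.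

(** An entry larger than all others, placed at the end of a row and of a column,
    neither breaks nor repairs the monotonicity of the rows and columns. *)
Lemma is_SYT_grow n c t : partition_shape t -> c \in 0 :: shape t ->
  is_SYT n.+1 (grow n.+1 c t) = is_SYT n t.
Proof.
move=> part_t c_t; rewrite /is_SYT /is_partition.
have [/andP[-> ->] /andP[-> ->]] := (part_t, partition_shape_grow n.+1 part_t c_t).
rewrite !andTb -!size_flatten (perm_size (flatten_grow _ _ _)) [size (_ :: _)]/=.
rewrite eqSS; congr andb.
have -> : perm_eq (flatten (grow n.+1 c t)) (iota 1 n.+1) =
          perm_eq (flatten t) (iota 1 n).
  rewrite (permPl (flatten_grow _ _ _)) iota1S.
  by rewrite perm_sym perm_rcons perm_cons perm_sym.
case: (boolP (perm_eq _ _)) => [perm_t|//]; rewrite !andTb.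
have lt_t : all (gtn n.+1) (flatten t).
  by apply/allP=> x; rewrite (perm_mem perm_t) mem_iota => /andP[].
congr andb.
  elim: t lt_t {part_t c_t perm_t} => //= r t IH.
  rewrite all_cat => /andP[lt_r lt_t]; case: ifP => _ /=; last by rewrite IH.
  by rewrite sorted_rcons_max.
have same_col k : 0 < k ->
    sorted ltn (column k (grow n.+1 c t)) = sorted ltn (column k t).
  move=> k0; rewrite column_grow //; case: ifP => // _; rewrite sorted_rcons_max //.
  by apply/allP=> x /column_sub-/(_ k0)/(allP lt_t).
rewrite iota1S all_rcons same_col // [column n.+1 t]column_nil; last first.
  by rewrite -size_flatten (perm_size perm_t) size_iota.
rewrite andTb; apply: eq_in_all => k; rewrite mem_iota => /andP[k0 _].
exact: same_col.
Qed.

Lemma grow_cat v a c t :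
  all (fun r => c < size r) a -> grow v c (a ++ t) = a ++ grow v c t.
Proof.
elim: a => //= r a IH /andP[lt_c lt_a].
by rewrite gtn_eqF // IH.
Qed.

(** The maximal entry ends its row, say after r, and nothing stands above it in
    its column; so the later rows are no longer than r, and r is the first
    row of its length once the entry is removed. *)
Lemma is_SYT_remove_max n u : is_SYT n.+1 u ->
  exists t c, [/\ partition_shape t, c \in 0 :: shape t & u = grow n.+1 c t].
Proof.
case/and4P=> /and3P[sorted_u u0 /eqP sum_u] perm_u rows_u cols_u.
have part_u : partition_shape u by rewrite /partition_shape sorted_u.
have le_u : all (geq n.+1) (flatten u).
  by apply/allP=> x; rewrite (perm_mem perm_u) mem_iota => /andP[].
have : n.+1 \in flatten u by rewrite (perm_mem perm_u) mem_iota /= ltnS leqnn.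
case/flattenP=> R Ru vR; have szR := shape_le_sumn Ru.
have sortedR := allP rows_u R Ru.
have leR x : x \in R -> x <= n.+1.
  by move=> xR; apply: (allP le_u); apply/flattenP; exists R.
have [r def_R] : exists r, R = rcons r n.+1.
  case/lastP: R vR sortedR leR {Ru szR} => // r y; rewrite mem_rcons inE.
  case/predU1P=> [->|vr]; first by exists r.
  rewrite (sorted_pairwise ltn_trans) -cats1 pairwise_cat.
  case/and3P=> /allP/(_ _ vr)/= + _ _; rewrite andbT => lt_y /(_ y).
  by rewrite mem_cat mem_head orbT leqNgt lt_y => /(_ isT).
subst R.
case/splitPr: Ru part_u cols_u sum_u le_u szR {perm_u rows_u sorted_u u0} => a b.
move=> part_u cols_u sum_u le_u szR.
have le_b : all (fun r' => size r' <= size r) b.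
  (* a later row longer than r would have an entry exceeding n.+1 above it *)
  have/(allP cols_u) : (size r).+1 \in iota 1 n.+1.
    by rewrite mem_iota /= ltnS; move: szR; rewrite sum_u size_rcons.
  rewrite /column filter_cat /= size_rcons leqnn map_cat /= nth_rcons ltnn eqxx.
  rewrite (sorted_pairwise ltn_trans) pairwise_cat /= => /and4P[_ _ gt_b _].
  apply/allP=> r' r'b; rewrite leqNgt; apply/negP=> lt_r.
  have : n.+1 < nth 0 r' (size r).
    by apply: (allP gt_b); apply: map_f; rewrite mem_filter lt_r.
  rewrite ltnNge => /negP; apply; apply: (allP le_u).
  rewrite flatten_cat mem_cat /= mem_cat; apply/orP; right; apply/orP; right.
  by apply/flattenP; exists r' => //; rewrite mem_nth.
move: part_u; rewrite /partition_shape /shape map_cat /= (sorted_pairwise geq_trans).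
rewrite pairwise_cat /= mem_cat inE !negb_or => /andP[].
case/and3P=> all_ab pw_a /andP[_ pw_b] /and3P[a0 _ b0].
have lt_a : all (fun r' => size r < size r') a.
  apply/allP=> r' r'a; have := allrelP all_ab (size r') (size r).+1.
  by rewrite size_rcons mem_head /= map_f // => /(_ isT isT).
have [r0|r_neq0] := eqVneq (size r) 0.
  exists a, 0; split=> //.
  - by rewrite /partition_shape (sorted_pairwise geq_trans) /shape pw_a a0.
  - rewrite -[a in RHS]cats0 grow_cat -?r0 //; congr cat.
    rewrite (size0nil r0) /=; congr cons.
    case: b le_b b0 {pw_b all_ab cols_u sum_u szR le_u} => //= r' b.
    by rewrite r0 leqn0 inE negb_or eq_sym => /andP[->].
exists (a ++ r :: b), (size r); split.
- rewrite /partition_shape /shape map_cat /= (sorted_pairwise geq_trans).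
  rewrite pairwise_cat /= mem_cat inE !negb_or a0 b0 pw_a pw_b eq_sym r_neq0 !andbT.
  rewrite all_map le_b /= andbT; apply/allrelP=> _ y /mapP[r1 /(allP lt_a) lt1 ->].
  rewrite inE => /predU1P[->|/mapP[r2 /(allP le_b) le2 ->]]; first exact: ltnW.
  exact: leq_trans le2 (ltnW lt1).
- by rewrite inE /shape map_cat mem_cat mem_head orbT orbT.
- by rewrite grow_cat //= eqxx.
Qed.

Fixpoint tableaux n : seq (seq (seq nat)) :=
  if n is m.+1
  then [seq grow n c t | t <- tableaux m, c <- undup (0 :: shape t)]
  else [:: [::]].

Lemma is_SYT_partition_shape n t : is_SYT n t -> partition_shape t.
Proof. by case/and4P=> /and3P[sorted_t t0 _] _ _ _; apply/andP. Qed.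

Lemma is_SYT_lt n t : is_SYT n t -> all (gtn n.+1) (flatten t).
Proof.
case/and4P=> _ /perm_mem mem_t _ _; apply/allP=> x.
by rewrite mem_t mem_iota => /andP[].
Qed.

Lemma mem_tableaux n t : (t \in tableaux n) = is_SYT n t.
Proof.
elim: n t => [|n IH] t.
  rewrite inE; apply/eqP/idP => [-> //|/and4P[/and3P[_ t0 /eqP sum_t] _ _ _]].
  by case: t t0 sum_t => //= r t; rewrite inE; case: (size r).
apply/allpairsPdep/idP => [[t' [c []]]|SYT_t].
  rewrite IH mem_undup => SYT_t' c_t' ->.
  by rewrite is_SYT_grow // (is_SYT_partition_shape SYT_t').
have [t' [c [part_t' c_t' def_t]]] := is_SYT_remove_max SYT_t.
by exists t', c; rewrite IH mem_undup -(is_SYT_grow _ part_t' c_t') -def_t.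
Qed.

Lemma restrict_grow_id n c t : is_SYT n t -> restrict n (grow n.+1 c t) = t.
Proof.
move=> SYT_t; rewrite restrict_grow // restrict_id ?(is_SYT_lt SYT_t) //.
by case/andP: (is_SYT_partition_shape SYT_t).
Qed.

Lemma column_of_grow_new n c t : is_SYT n t -> c \in 0 :: shape t ->
  column_of n.+1 (grow n.+1 c t) = c.+1.
Proof.
move=> SYT_t; apply: column_of_new; apply/negP=> /(allP (is_SYT_lt SYT_t)).
by rewrite /= ltnn.
Qed.

(** The smaller tableau is the restriction to the entries at most n, and c is
    given by the column of n + 1. *)
Lemma tableaux_uniq n : uniq (tableaux n).
Proof.
elim: n => // n IH; apply: allpairs_uniq_dep => [//|t _|]; first exact: undup_uniq.
move=> _ _ /allpairsPdep[t [c [tn ct ->]]] /allpairsPdep[t' [c' [t'n c't' ->]]] /=.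
move: tn t'n ct c't'; rewrite !mem_tableaux !mem_undup => tn t'n ct c't' eq_g.
have eq_t : t = t'.
  by rewrite -(restrict_grow_id c tn) eq_g restrict_grow_id.
move: t'n c't' eq_g; rewrite -{}eq_t => _ c't' eq_g; congr (Tagged _ _).
by apply: succn_inj; rewrite -(column_of_grow_new tn ct) eq_g column_of_grow_new.
Qed.

(** * The recurrence for tableaux *)

Definition weight n t : int := (\prod_(1 <= i < n.+1) delta i t)%R.

Lemma weight_grow n c t :
  weight n.+1 (grow n.+1 c t) = (weight n t * delta n.+1 (grow n.+1 c t))%R.
Proof.
rewrite /weight big_nat_recr //=; congr (_ * _)%R.
by apply: eq_big_nat => i /andP[_ lt_i]; rewrite delta_grow_old.
Qed.

(** The new row gives the factor 2n + 1 - l, where l is the number of rows of t.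
    The other boxes give the multiplicities of the distinct row lengths of t,
    which add up to l. *)
Lemma sum_grow n t : is_SYT n t ->
  (\sum_(c <- undup (0%N :: shape t))
     weight n.+1 (grow n.+1 c t) *: 'X^(size (grow n.+1 c t)) =
   weight n t *: euler_step n 'X^(size t))%R.
Proof.
move=> SYT_t; have part_t := is_SYT_partition_shape SYT_t.
have lt_t := is_SYT_lt SYT_t; have /andP[_ t0] := part_t.
rewrite [undup _]/= (negPf t0) big_cons weight_grow delta_grow_new ?mem_head //=.
rewrite size_grow ?mem_head //= addn1 euler_stepXn scalerDr !scalerA addrC.
congr (_ + _)%R; last first.
  congr (_ * _ *: _)%R; rewrite (_ : 2 * n.+1 = (2 * n + 1).+1);
    last by rewrite addn1 mulnS.
  by rewrite (intS (2 * n + 1)) (intS (size t)) opprD addrACA subrr add0r.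
transitivity (weight n t *:
    \sum_(c <- undup (shape t)) 'X^(size t) *+ count_mem c (shape t))%R.
  rewrite scaler_sumr; apply: eq_big_seq => c; rewrite mem_undup => c_t.
  have c_t0 : c \in 0 :: shape t by rewrite inE c_t orbT.
  have c0 : c == 0 = false by apply: contraNF t0 => /eqP <-.
  rewrite weight_grow delta_grow_new // size_grow // c0 addn0 -scalerA.
  by rewrite -natz scaler_nat.
rewrite -scalerA; congr (_ *: _)%R.
have := big_undup_iterop_count +%R (shape t) xpredT (fun=> 'X^(size t) : {poly int})%R.
rewrite big_const_seq iter_addr_0 count_predT size_map -[X in _ = X]scaler_nat.
rewrite natz => <-.
by apply: eq_bigr => c _.
Qed.

Lemma tableaux_step n :
  (\sum_(t <- tableaux n.+1) weight n.+1 t *: 'X^(size t) =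
   euler_step n (\sum_(t <- tableaux n) weight n t *: 'X^(size t)))%R.
Proof.
rewrite big_allpairs_dep euler_step_sum; apply: eq_big_seq => t.
by rewrite mem_tableaux => /sum_grow.
Qed.

Lemma SYT_sum n :
  (\sum_(T in SYT n)
     (\prod_(1 <= i < n.+1) delta i (rows T)) *: 'X^(size (shape (rows T))) =
   \sum_(t <- tableaux n) weight n t *: 'X^(size t))%R.
Proof.
under eq_bigr do rewrite size_map.
apply: (sum_image (fun t => weight n t *: 'X^(size t))%R (@rows_inj n)
         (tableaux_uniq n)).
  by move=> t; apply: mem_tableaux.
exact: is_SYT_rows.
Qed.

Theorem theorem43 (n : nat) (hn : (1 <= n)%N) :
  (second_eulerian n =
   \sum_(T in SYT n)
     (\prod_(1 <= i < n.+1) delta i (rows T)) *: 'X^(size (shape (rows T))))%R.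
Proof.
rewrite SYT_sum; elim: n {hn} => [|n IH].
  by rewrite second_eulerian_list !big_seq1 des_count /weight big_geq // scale1r.
by rewrite stirling_step tableaux_step IH.
Qed.
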